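(* Let $q$ be a prime power, $u\ge 1$, $m\ge 2$, and $n_a = (q^{um}-1)/(q^u-1)$. Let $H^{q^u}_m$ be a parity check matrix of the $q^u$-ary Hamming code of length $n_a$, and let $n_b$ be an integer with $4 \leq n_b \leq (q^u-1)n_a + 1$. Let $R^q_{n_b} = [I_{n_b-1} \mid -\mathbf{1}^T]$ be the $(n_b-1)\times n_b$ parity check matrix over $\mathbb{F}_q$ of the $q$-ary repetition $[n_b,1,n_b]_q$ code. Then the linear code $C$ over $\mathbb{F}_{q^u}$ with parity check matrix $H^{q^u}_m \otimes R^q_{n_b}$: (a) is a $q^u$-ary uniformly packed (in the wide sense) $[n,k,d]_{q^u}$ code with covering radius $\rho = n_b - 1$, where $n = n_a n_b$, $k = n - m(n_b-1)$, $d = 3$; (b) is not completely regular.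
   Context: $H^{Q}_m$ is an $m \times \frac{Q^m-1}{Q-1}$ matrix over $\mathbb{F}_Q$ with nonzero, pairwise linearly independent columns. $I_{t}$ is the identity matrix and $\mathbf 1$ the all-ones row vector. The Kronecker product $A\otimes B$ replaces each entry $a_{r,s}$ of $A$ by $a_{r,s}B$. Covering radius $\rho=\max_{\mathbf v}d(\mathbf v,C)$ (Hamming distance). A $Q$-ary code $C$ of length $n$ with covering radius $\rho$ is uniformly packed in the wide sense if there are rational numbers $\alpha_0,\ldots,\alpha_\rho$ with $\sum_{k=0}^{\rho}\alpha_k f_k(\mathbf v)=1$ for all $\mathbf v\in\mathbb{F}_Q^n$, where $f_k(\mathbf v)$ is the number of codewords at distance $k$ from $\mathbf v$. With $C(i)=\{\mathbf x: d(\mathbf x,C)=i\}$, $C$ is completely regular if for each $l\ge0$ every $\mathbf x\in C(l)$ has the same number of neighbors (vectors at distance 1) in $C(l-1)$ and the same number of neighbors in $C(l+1)$. *)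

(* Defs.v *)
From HB Require Import structures.
From mathcomp Require Import all_boot all_order all_algebra all_field.
From mathcomp.real_closed Require Export mxtens.

Set Implicit Arguments.
Unset Strict Implicit.
Unset Printing Implicit Defensive.

Import GRing.Theory.
Local Open Scope ring_scope.

Section Codes.

Variables (F : finFieldType) (n : nat).
Implicit Types (C : {set 'rV[F]_n}) (x y v : 'rV[F]_n).

Definition hamming_dist x y : nat := #|[set i : 'I_n | x 0 i != y 0 i]|.

(* The default value n is never smaller than a Hamming distance, so for
   nonempty C this is the minimum of hamming_dist x c over c \in C. *)
Definition dist_to_code x C : nat :=
  \big[minn/n]_(c in C) hamming_dist x c.

Definition covering_radius C : nat := \max_(v : 'rV[F]_n) dist_to_code v C.

Definition min_distance_is C (d : nat) : Prop :=
  (exists x y, [/\ x \in C, y \in C, x != y & hamming_dist x y = d]) /\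
  (forall x y, x \in C -> y \in C -> x != y -> (d <= hamming_dist x y)%N).

(* [n, k, d] code: the length n is carried by the type of C. *)
Definition linear_code_params C (k d : nat) : Prop :=
  (exists V : {vspace 'rV[F]_n}, C =i V /\ \dim V = k) /\ min_distance_is C d.

Definition codewords_at C (k : nat) v : nat :=
  #|[set c in C | hamming_dist v c == k]|.

Definition uniformly_packed_wide C : Prop :=
  exists alpha : 'I_(covering_radius C).+1 -> rat,
    forall v, \sum_k alpha k * (codewords_at C k v)%:R = 1.

(* C(i), indexed by int so that C(-1) is empty. *)
Definition code_shell C (i : int) : {set 'rV[F]_n} :=
  [set x | (dist_to_code x C)%:Z == i].

Definition neighbors_in (A : {set 'rV[F]_n}) x : nat :=
  #|[set y in A | hamming_dist x y == 1%N]|.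

Definition completely_regular C : Prop :=
  forall (l : nat) x y, x \in code_shell C l%:Z -> y \in code_shell C l%:Z ->
    neighbors_in (code_shell C (l%:Z - 1)) x
      = neighbors_in (code_shell C (l%:Z - 1)) y
    /\ neighbors_in (code_shell C (l%:Z + 1)) x
      = neighbors_in (code_shell C (l%:Z + 1)) y.

Definition parity_check_code (r : nat) (H : 'M[F]_(r, n)) : {set 'rV[F]_n} :=
  [set x | H *m x^T == 0].

(* Column condition only; such an H is a parity check matrix of the Hamming
   code when moreover n = (Q^m - 1) / (Q - 1), with Q = #|F|. *)
Definition hamming_columns (m : nat) (H : 'M[F]_(m, n)) : Prop :=
  (forall j, col j H != 0) /\
  (forall i j, i != j -> free [:: col i H; col j H]).

End Codes.

(* The matrix [I | -1^T], see repetition_pcmE. *)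
Definition repetition_pcm (R : pzRingType) (n : nat) : 'M[R]_(n - 1, n) :=
  \matrix_(i < n - 1, j < n)
    if (j < n - 1)%N then (i == j :> nat)%:R else -1.

Lemma repetition_pcmE (R : pzRingType) (t : nat) :
  repetition_pcm R t.+1 =
  castmx (esym (subn1 t.+1), addn1 t) (row_mx 1%:M (- const_mx 1)).
Proof.
apply/matrixP=> i j; rewrite castmxE !mxE.
have ltE k : (k < t.+1 - 1)%N = (k < t)%N by rewrite subn1.
case: splitP => k /= kE; rewrite !mxE kE ltE.
  by rewrite ltn_ord.
by rewrite ltnNge leq_addr.
Qed.

(* Main.v *)
Require Import Defs.
From mathcomp Require Import all_boot all_order all_algebra all_field.
From mathcomp Require Import zify.

(** Split a word into [nb] blocks of length [na] and replace each block by its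
    Hamming syndrome.  As the Hamming code is perfect, this syndrome map sends
    the neighbours of a word bijectively onto the neighbours of its image: it
    is a covering of the Hamming graph on the words of [nb] letters from the
    alphabet of all syndromes.  The code is the preimage of the constant words.

    Since paths lift, the distance to the code is the distance from the image
    to the constant words, which is [nb] minus the largest multiplicity of a
    letter.  Distinct words with the same image are at distance at least 3, and
    a triangle with a lift that does not close up yields two at distance 3.

    Uniform packing.  Walks of length [k] from [x] to the code correspond to
    walks of length [k] from the image of [x] to the constant words.  In both
    graphs the number of walks of length [k] between two words is a function of
    their distance [r] which vanishes for [r > k] and equals [k!] for [r = k].
    By triangularity, every sum over the constant words of a function of the
    distance that vanishes from [k] on is a combination of the numbers
    [f_0], ..., [f_(k-1)] of codewords at given distances from [x].  For
    [k = nb], take [(nb - r) / nb]: the multiplicities of all letters sum to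
    [nb].

    Failure of complete regularity.  The number of neighbours of [x] closer to
    the code is the distance from [x] to the code times the number of letters
    of largest multiplicity in the image of [x].  As [nb >= 4], a word whose
    largest multiplicity is 2 can have one or two such letters. *)

Set Implicit Arguments.
Unset Strict Implicit.
Unset Printing Implicit Defensive.

Import Order.TTheory GRing.Theory Num.Theory.

Local Open Scope nat_scope.

Lemma sum_eq_mem (T : finType) (A : {set T}) x :
  \sum_(y in A) (x == y) = (x \in A).
Proof.
have [xA|xA] := boolP (x \in A); last first.
  by rewrite big1 // => y yA; case: eqP xA => // ->; rewrite yA.
rewrite (bigD1 x) //= eqxx big1 // => y /andP[_ /negPf].
by rewrite eq_sym => ->.
Qed.

Lemma addr_eq_id (V : zmodType) (x y : V) : (x + y == x)%R = (y == 0)%R.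
Proof. by rewrite -[X in _ == X]addr0 (inj_eq (addrI x)). Qed.

Section WordDistance.

Variables I T : finType.
Implicit Types (s t c : {ffun I -> T}) (i j : I) (a b : T).

Definition word_dist s t : nat := #|[set i | s i != t i]|.

Definition update s j a : {ffun I -> T} :=
  [ffun i => if i == j then a else s i].

Lemma card_agreement s t : #|[pred i | s i == t i]| = #|I| - word_dist s t.
Proof.
rewrite -(cardC [pred i | s i == t i]) /word_dist cardsE.
have -> : #|[pred i | s i != t i]| = #|[predC [pred i | s i == t i]]|.
  exact: eq_card.
by rewrite addnK.
Qed.

Lemma word_dist_eq0 s t : (word_dist s t == 0) = (s == t).
Proof.
rewrite cards_eq0; apply/eqP/eqP => [/setP st|->].
  by apply/ffunP => i; have := st i; rewrite !inE => /negbFE/eqP.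
by apply/setP => i; rewrite !inE eqxx.
Qed.

Lemma word_dist_sym s t : word_dist s t = word_dist t s.
Proof. by apply: eq_card => i; rewrite !inE eq_sym. Qed.

Lemma word_dist_triangle t s c :
  word_dist s c <= word_dist s t + word_dist t c.
Proof.
apply: leq_trans (leq_card_setU _ _).1; apply/subset_leq_card/subsetP => i.
by rewrite !inE; case: (s i =P t i) => [->|].
Qed.

Lemma word_dist_update s t j a :
  word_dist (update s j a) t + (s j != t j) = word_dist s t + (a != t j).
Proof.
rewrite /word_dist (cardsD1 j [set i | update s j a i != t i]).
rewrite (cardsD1 j [set i | s i != t i]) !inE ffunE eqxx.
suff -> : [set i | update s j a i != t i] :\ j = [set i | s i != t i] :\ j.
  by lia.
by apply/setP => i; rewrite !inE ffunE; case: eqP.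
Qed.

Lemma word_dist_update_self s j a : word_dist s (update s j a) = (a != s j).
Proof.
have := word_dist_update s (update s j a) j a; rewrite !ffunE !eqxx addn0.
have /eqP -> : word_dist (update s j a) (update s j a) == 0.
  by rewrite word_dist_eq0.
by move=> <-; rewrite eq_sym.
Qed.

Lemma word_dist_update_same s j a b :
  word_dist (update s j a) (update s j b) = (a != b).
Proof.
have := word_dist_update s (update s j b) j a.
by rewrite word_dist_update_self !ffunE eqxx (eq_sym b) addnC => /addnI.
Qed.

Lemma word_dist_update_neq s j k a b : j != k ->
  word_dist (update s j a) (update s k b) = (a != s j) + (b != s k).
Proof.
move=> /negPf jk; have := word_dist_update s (update s k b) j a.
by rewrite word_dist_update_self !ffunE jk eqxx addn0 addnC.
Qed.

Lemma word_distS s t k : word_dist s t = k.+1 ->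
  exists j, t j != s j /\ word_dist (update s j (t j)) t = k.
Proof.
move=> st; have /card_gt0P[j] : (0 < #|[set i | s i != t i]|).
  by rewrite [#|_|]st.
rewrite inE => stj; exists j; split; first by rewrite eq_sym.
by have := word_dist_update s t j (t j); rewrite st stj eqxx; lia.
Qed.

Lemma word_dist1P s t :
  reflect (exists j a, a != s j /\ t = update s j a) (word_dist s t == 1).
Proof.
apply: (iffP eqP) => [/word_distS[j [sj]]|[j [a [sa ->]]]].
  by move/eqP; rewrite word_dist_eq0 => /eqP <-; exists j, (t j).
by rewrite word_dist_update_self sa.
Qed.

Lemma big_neighbors (R : Type) (idx : R) (op : Monoid.com_law idx)
    (g : {ffun I -> T} -> R) s :
  \big[op/idx]_(t | word_dist s t == 1) g t =
  \big[op/idx]_j \big[op/idx]_(a | a != s j) g (update s j a).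
Proof.
rewrite pair_big_dep /=.
pose D := [set ja : I * T | ja.2 != s ja.1].
pose h (ja : I * T) := update s ja.1 ja.2.
have h_inj : {in D &, injective h}.
  move=> [j a] [j' a']; rewrite !inE /= => sa _ /ffunP/(_ j).
  rewrite !ffunE eqxx /=; case: eqP => [-> ->//|_ sja].
  by rewrite sja eqxx in sa.
have -> : \big[op/idx]_(t | word_dist s t == 1) g t =
    \big[op/idx]_(t in h @: D) g t.
  apply: eq_bigl => t; apply/word_dist1P/imsetP => [[j [a [sa ->]]]|[[j a]]].
    by exists (j, a); rewrite ?inE.
  by rewrite inE => sa ->; exists j, a.
by rewrite big_imset //; apply: eq_bigl => ja; rewrite inE.
Qed.

End WordDistance.

(* The adjacency operator of the Hamming graph on words of length [n] over [q]
   letters, acting on functions of the distance to a fixed word. *)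
Definition hamming_adjacency (n q : nat) (f : nat -> nat) (r : nat) : nat :=
  (n - r) * q.-1 * f r.+1 + r * q.-2 * f r + r * f r.-1.

Lemma sum_neighbors_word_dist (I T : finType) (f : nat -> nat)
    (s c : {ffun I -> T}) :
  \sum_(t | word_dist s t == 1) f (word_dist t c) =
  hamming_adjacency #|I| #|T| f (word_dist s c).
Proof.
set r := word_dist s c.
have agree j : s j = c j ->
    \sum_(a | a != s j) f (word_dist (update s j a) c) = #|T|.-1 * f r.+1.
  move=> sj; rewrite -(cardC1 (s j)) -sum_nat_const; apply: eq_bigr => a sja.
  by have := word_dist_update s c j a; rewrite -sj sja eqxx addn0 addn1 => ->.
have differ j : s j != c j ->
    \sum_(a | a != s j) f (word_dist (update s j a) c) =
    f r.-1 + #|T|.-2 * f r.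
  move=> sj; rewrite (bigD1 (c j)) 1?eq_sym //=; congr (_ + _).
    have := word_dist_update s c j (c j).
    by rewrite sj eqxx addn0 addn1 -/r => <-.
  rewrite -(cardC1 (s j)) (cardD1 (c j)) !inE eq_sym sj /= -sum_nat_const.
  apply: eq_big => [a|a /andP[_ ca]]; first by rewrite !inE andbC.
  by have := word_dist_update s c j a; rewrite sj ca => /addIn ->.
rewrite big_neighbors (bigID (fun j => s j == c j)) /=.
rewrite (eq_bigr _ (fun j sj => agree j (eqP sj))).
rewrite (eq_bigr _ (fun j sj => differ j sj)) !sum_nat_const.
rewrite card_agreement -[#|_|]cardsE -/(word_dist s c) -/r.
by rewrite mulnDr !mulnA addnA addnAC.
Qed.

Section WalkCount.

Variables n q : nat.

(* Number of walks of length [k] between two words at a given distance. *)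
Definition walk_count (k : nat) : nat -> nat :=
  iter k (hamming_adjacency n q) (fun r => r == 0).

Lemma walk_count_eq0 k r : k < r -> walk_count k r = 0.
Proof.
elim: k r => [|k IHk] [|r] // kr; rewrite /walk_count iterS.
by rewrite /hamming_adjacency -/(walk_count k) !IHk ?muln0 //; lia.
Qed.

Lemma walk_count_diag k : walk_count k k = k`!.
Proof.
elim: k => [|k IHk] //; rewrite /walk_count iterS /hamming_adjacency.
by rewrite -/(walk_count k) /= IHk !walk_count_eq0 ?muln0.
Qed.

End WalkCount.

Section Multiplicity.

Variables I T : finType.
Implicit Types (s : {ffun I -> T}) (j : I) (a b : T).

Definition multiplicity s a : nat := #|[pred i | s i == a]|.

Definition max_multiplicity s : nat := \max_a multiplicity s a.

Definition modes s : {set T} :=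
  [set a | multiplicity s a == max_multiplicity s].

Lemma multiplicity_le_card s a : multiplicity s a <= #|I|.
Proof. exact: max_card. Qed.

Lemma word_dist_const s a : word_dist s [ffun=> a] = #|I| - multiplicity s a.
Proof.
have -> : multiplicity s a = #|[pred i | s i == [ffun=> a] i]|.
  by apply: eq_card => i; rewrite !inE ffunE.
by rewrite card_agreement subKn ?max_card.
Qed.

Lemma multiplicity_update s j b a :
  multiplicity (update s j b) a + (s j == a) = multiplicity s a + (b == a).
Proof.
have := word_dist_update s [ffun=> a] j b; rewrite !word_dist_const ffunE.
have := multiplicity_le_card s a; have := multiplicity_le_card (update s j b) a.
by case: eqP; case: eqP => /=; lia.
Qed.

Lemma sum_multiplicity s : \sum_a multiplicity s a = #|I|.
Proof.
rewrite -sum1_card (partition_big s xpredT) //=.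
by apply: eq_bigr => a _; rewrite sum1_card.
Qed.

Lemma multiplicity_le_max s a : multiplicity s a <= max_multiplicity s.
Proof. exact: (leq_bigmax (F := multiplicity s)). Qed.

Lemma max_multiplicity_attained s : 0 < #|I| ->
  exists a, multiplicity s a = max_multiplicity s.
Proof.
case/card_gt0P=> j _; have T_gt0 : 0 < #|T| by apply/card_gt0P; exists (s j).
by have [a sa] := bigop.eq_bigmax (multiplicity s) T_gt0; exists a.
Qed.

Lemma max_multiplicity_le_card s : max_multiplicity s <= #|I|.
Proof. by apply/bigmax_leqP => a _; exact: multiplicity_le_card. Qed.

Lemma max_multiplicity_update s j b : b != s j ->
  (max_multiplicity (update s j b) == (max_multiplicity s).+1) =
  (b \in modes s).
Proof.
move=> bj; rewrite inE; have I_gt0 : 0 < #|I| by apply/card_gt0P; exists j.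
have update_le a : multiplicity (update s j b) a <= multiplicity s a + (b == a).
  by rewrite -(multiplicity_update s j) leq_addr.
have update_at_j : multiplicity (update s j b) b = (multiplicity s b).+1.
  by have := multiplicity_update s j b b; rewrite eqxx eq_sym (negPf bj); lia.
have := multiplicity_le_max (update s j b) b.
have [a <-] := max_multiplicity_attained (update s j b) I_gt0.
have := multiplicity_le_max s a; have := multiplicity_le_max s b.
by rewrite update_at_j; have := update_le a; case: (b =P a) => [<-|]; lia.
Qed.

Lemma card_neighbors_max_multiplicityS s :
  #|[set t | (word_dist s t == 1) &&
             (max_multiplicity t == (max_multiplicity s).+1)]| =
  (#|I| - max_multiplicity s) * #|modes s|.
Proof.
rewrite -sum1dep_card big_mkcondr big_neighbors /=.
transitivity (\sum_j \sum_(a in modes s | s j != a) 1).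
  apply: eq_bigr => j _; rewrite [RHS]big_mkcond [LHS]big_mkcond /=.
  apply: eq_bigr => a _; rewrite eq_sym andbC; case: ifPn => // sja.
  by rewrite max_multiplicity_update // eq_sym.
rewrite (exchange_big_dep [in modes s]) /=; last by move=> j a _ /andP[].
rewrite mulnC -sum_nat_const; apply: eq_bigr => a mode_a.
under eq_bigl do rewrite mode_a; rewrite inE in mode_a.
rewrite -(eqP mode_a) sum1_card -(cardC [pred i | s i == a]) addKn.
by apply: eq_card => j; rewrite !inE.
Qed.

Lemma max_multiplicity_eq s k a : multiplicity s a = k ->
  (forall b, multiplicity s b <= k) -> max_multiplicity s = k.
Proof.
move=> sa s_le; apply/eqP; rewrite eqn_leq -{2}sa multiplicity_le_max andbT.
exact/bigmax_leqP.
Qed.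

Lemma max_multiplicity_gt0 s : 0 < #|I| -> 0 < max_multiplicity s.
Proof.
case/card_gt0P=> j _; apply: leq_trans (multiplicity_le_max s (s j)).
by apply/card_gt0P; exists j; rewrite inE.
Qed.

Lemma injective_max_multiplicity_le1 s : injective s -> max_multiplicity s <= 1.
Proof.
move=> s_inj; apply/bigmax_leqP => a _; apply/card_le1P => i.
by rewrite !inE => /eqP <- j; rewrite !inE (inj_eq s_inj).
Qed.

End Multiplicity.

Section ConstantWords.

Variables I T : finType.
Hypothesis I_gt0 : 0 < #|I|.

Definition constant_words : {set {ffun I -> T}} := [set [ffun=> a] | a : T].

Lemma const_word_inj : injective (fun a : T => [ffun=> a] : {ffun I -> T}).
Proof.
by have /card_gt0P[i _] := I_gt0; move=> a b /ffunP/(_ i); rewrite !ffunE.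
Qed.

Lemma word_dist_const_const (a b : T) : a != b ->
  word_dist ([ffun=> a] : {ffun I -> T}) [ffun=> b] = #|I|.
Proof. by move=> ab; apply: eq_card => i; rewrite !inE !ffunE ab. Qed.

End ConstantWords.

Lemma multiplicity_tnth (T : finType) n (l : n.-tuple T) a :
  multiplicity [ffun i => tnth l i] a = count_mem a l.
Proof.
rewrite -[in RHS](map_tnth_enum l) count_map -sum1_count big_enum_cond /=.
by rewrite sum1_card; apply: eq_card => i; rewrite !inE ffunE.
Qed.

(* The words [a a c d v] and [a a c c v], where [a], [c], [d] and the letters
   of [v] are distinct. *)
Lemma exists_unequal_modes (T : finType) n : n.+3 <= #|T| ->
  exists s t : {ffun 'I_n.+4 -> T},
    [/\ max_multiplicity s = 2, max_multiplicity t = 2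
      & #|modes s| != #|modes t|].
Proof.
rewrite cardE => le_nT.
have := take_uniq n.+3 (enum_uniq T); have := size_takel le_nT.
case: (take _ _) => [|a [|c [|d v]]] //= [/eqP sz_v] letters_uniq.
pose w : n.-tuple T := Tuple sz_v.
pose s := [ffun i => tnth [tuple of [:: a, a, c, d & w]] i].
pose t := [ffun i => tnth [tuple of [:: a, a, c, c & w]] i].
have count_le1 x : (a == x) + ((c == x) + ((d == x) + count_mem x v)) <= 1.
  have uniq_acdv : uniq [:: a, c, d & v] := letters_uniq.
  by have /= -> := count_uniq_mem x uniq_acdv; exact: leq_b1.
have neq_ac : a != c by move: letters_uniq; rewrite /= inE negb_or; case: eqP.
have sE x : multiplicity s x =
    (a == x) + ((a == x) + ((c == x) + ((d == x) + count_mem x v))).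
  exact: multiplicity_tnth.
have tE x : multiplicity t x =
    (a == x) + ((a == x) + ((c == x) + ((c == x) + count_mem x v))).
  exact: multiplicity_tnth.
have max_s : max_multiplicity s = 2.
  apply: (max_multiplicity_eq (a := a)) => [|x]; rewrite sE.
    by have := count_le1 a; rewrite eqxx; lia.
  by have := count_le1 x; lia.
have max_t : max_multiplicity t = 2.
  apply: (max_multiplicity_eq (a := a)) => [|x]; rewrite tE.
    by have := count_le1 a; rewrite eqxx; lia.
  by have := count_le1 x; lia.
exists s, t; split=> //.
have -> : modes s = [set a].
  apply/setP => x; rewrite !inE max_s sE (eq_sym x).
  by have := count_le1 x; lia.
have -> : modes t = [set a; c].
  apply/setP => x; rewrite !inE max_t tE !(eq_sym x).
  by have := count_le1 x; lia.
by rewrite cards1 cards2 neq_ac.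
Qed.

Section RowWords.

Variables (F : finFieldType) (n : nat).
Implicit Types x y z c : 'rV[F]_n.

Definition word_of_row x : {ffun 'I_n -> F} := [ffun i => x 0%R i].

Lemma word_of_row_bij : bijective word_of_row.
Proof.
exists (fun s : {ffun 'I_n -> F} => \row_i s i)%R => [x|s].
  by apply/rowP=> i; rewrite mxE ffunE.
by apply/ffunP => i; rewrite ffunE mxE.
Qed.

Lemma hamming_distE x y :
  hamming_dist x y = word_dist (word_of_row x) (word_of_row y).
Proof. by apply: eq_card => i; rewrite !inE !ffunE. Qed.

Lemma hamming_dist_eq0 x y : (hamming_dist x y == 0) = (x == y).
Proof. by rewrite hamming_distE word_dist_eq0 (bij_eq word_of_row_bij). Qed.

Lemma hamming_dist_sym x y : hamming_dist x y = hamming_dist y x.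
Proof. by rewrite !hamming_distE word_dist_sym. Qed.

Lemma hamming_dist_triangle y x z :
  hamming_dist x z <= hamming_dist x y + hamming_dist y z.
Proof.
by rewrite !hamming_distE word_dist_triangle.
Qed.

Lemma hamming_distS x y k : hamming_dist x y = k.+1 ->
  exists2 z, hamming_dist x z = 1 & hamming_dist z y = k.
Proof.
have [row_of rowK wordK] := word_of_row_bij.
rewrite hamming_distE => /word_distS[j [xyj dk]].
exists (row_of (update (word_of_row x) j (word_of_row y j))).
  by rewrite hamming_distE wordK word_dist_update_self xyj.
by rewrite hamming_distE wordK.
Qed.

Lemma sum_neighbors_hamming_dist (f : nat -> nat) x c :
  \sum_(y | hamming_dist x y == 1) f (hamming_dist y c) =
  hamming_adjacency n #|F| f (hamming_dist x c).
Proof.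
have := sum_neighbors_word_dist f (word_of_row x) (word_of_row c).
rewrite card_ord -hamming_distE => <-.
rewrite [RHS](reindex word_of_row) /=; last exact/onW_bij/word_of_row_bij.
by apply: eq_big => [y|y _]; rewrite hamming_distE.
Qed.

Lemma sum_codewords_at (C : {set 'rV[F]_n}) (f : nat -> nat) k x :
    (forall r, k <= r -> f r = 0) ->
  \sum_(c in C) f (hamming_dist x c) = \sum_(i < k) f i * codewords_at C i x.
Proof.
move=> f_supp; under [RHS]eq_bigr do rewrite mulnC -sum_nat_const.
rewrite (exchange_big_dep [in C]) /=; last first.
  by move=> i c _; rewrite inE => /andP[].
apply: eq_bigr => c cC; have [kr|rk] := leqP k (hamming_dist x c).
  rewrite f_supp // big1 // => i; rewrite inE cC /= => /eqP xc.
  by have := ltn_ord i; rewrite -xc ltnNge kr.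
rewrite (big_pred1 (Ordinal rk)) // => i.
by rewrite inE cC /= eq_sym.
Qed.

Lemma word_of_row_add_delta x p a :
  word_of_row (x + a *: delta_mx 0 p)%R =
  update (word_of_row x) p (x 0 p + a)%R.
Proof.
apply/ffunP => i; rewrite !ffunE !mxE eqxx /=.
by case: eqP => [->|_]; rewrite ?mulr1 ?mulr0 ?addr0.
Qed.

Lemma hamming_dist1P x y :
  reflect (exists p a, a != 0%R /\ y = (x + a *: delta_mx 0 p)%R)
          (hamming_dist x y == 1).
Proof.
rewrite hamming_distE; apply: (iffP (word_dist1P _ _)) => -[p [a [a_neq yE]]].
  rewrite ffunE -subr_eq0 in a_neq; exists p, (a - x 0 p)%R; split=> //.
  apply: (bij_inj word_of_row_bij); rewrite word_of_row_add_delta yE.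
  by rewrite (addrC (x 0 p)%R) subrK.
exists p, (x 0 p + a)%R; rewrite yE word_of_row_add_delta ffunE.
by rewrite addr_eq_id.
Qed.

End RowWords.

Section Coverings.

Variables (F : finFieldType) (n : nat) (J W : finType).
Implicit Types (x y z : 'rV[F]_n) (s t : {ffun J -> W}).

Definition hamming_covering (sigma : 'rV[F]_n -> {ffun J -> W}) : Prop :=
  forall x,
    {in [set y | hamming_dist x y == 1] &, injective sigma} /\
    sigma @: [set y | hamming_dist x y == 1] =
      [set s | word_dist (sigma x) s == 1].

Variable sigma : 'rV[F]_n -> {ffun J -> W}.
Hypothesis sigma_cover : hamming_covering sigma.

Lemma covering_neighbor x y : hamming_dist x y = 1 ->
  word_dist (sigma x) (sigma y) = 1.
Proof.
have [_ /setP/(_ (sigma y)) img] := sigma_cover x => xy; apply/eqP.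
by rewrite inE in img; rewrite -img imset_f // inE xy.
Qed.

Lemma covering_neighbor_lift x s : word_dist (sigma x) s = 1 ->
  exists2 y, sigma y = s & hamming_dist x y = 1.
Proof.
have [_ /setP/(_ s)] := sigma_cover x; rewrite inE => img xs.
move: img; rewrite xs => /imsetP[y]; rewrite inE => /eqP xy ->.
by exists y.
Qed.

Lemma covering_neighbor_inj z x y : hamming_dist z x = 1 ->
  hamming_dist z y = 1 -> sigma x = sigma y -> x = y.
Proof.
by move=> zx zy; have [inj _] := sigma_cover z; apply: inj; rewrite inE ?zx ?zy.
Qed.

Lemma sum_neighbors_covering (g : {ffun J -> W} -> nat) x :
  \sum_(y | hamming_dist x y == 1) g (sigma y) =
  \sum_(s | word_dist (sigma x) s == 1) g s.
Proof.
have [inj img] := sigma_cover x; rewrite -[RHS]big_set -img big_imset //.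
by rewrite big_set.
Qed.

Lemma covering_dist_le x y :
  word_dist (sigma x) (sigma y) <= hamming_dist x y.
Proof.
move dk : (hamming_dist x y) => k; elim: k x dk => [|k IHk] x.
  by move/eqP; rewrite hamming_dist_eq0 leqn0 word_dist_eq0 => /eqP ->.
case/hamming_distS => z xz /IHk zy.
apply: leq_trans (word_dist_triangle (sigma z) _ _) _.
by rewrite (covering_neighbor xz) add1n.
Qed.

Lemma covering_lift x s :
  exists2 y, sigma y = s & hamming_dist x y = word_dist (sigma x) s.
Proof.
suff [y ys xy] :
    exists2 y, sigma y = s & hamming_dist x y <= word_dist (sigma x) s.
  exists y => //; apply/eqP; rewrite eqn_leq xy.
  by have := covering_dist_le x y; rewrite ys.
move dk : (word_dist (sigma x) s) => k; elim: k x dk => [|k IHk] x.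
  move/eqP; rewrite word_dist_eq0 => /eqP <-.
  by exists x; rewrite // leqn0 hamming_dist_eq0.
case/word_distS => j [sj /esym ks].
have [|z zs xz] := @covering_neighbor_lift x (update (sigma x) j (s j)).
  by rewrite word_dist_update_self sj.
have [|y ys zy] := IHk z; first by rewrite zs.
exists y => //; apply: leq_trans (hamming_dist_triangle z _ _) _.
by rewrite xz add1n.
Qed.

Lemma covering_surj s : exists x, sigma x = s.
Proof. by have [x <- _] := covering_lift 0%R s; exists x. Qed.

Lemma covering_fiber_dist_ge3 x y :
  sigma x = sigma y -> x != y -> 3 <= hamming_dist x y.
Proof.
move=> sxy xy; have sxx : word_dist (sigma x) (sigma y) = 0.
  by apply/eqP; rewrite word_dist_eq0 sxy.
case dxy : (hamming_dist x y) => [|[|[|//]]].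
- by case/eqP: xy; apply/eqP; rewrite -hamming_dist_eq0 dxy.
- by have := covering_neighbor dxy; rewrite sxx.
- have [z xz zy] := hamming_distS dxy; case/eqP: xy.
  by apply: (@covering_neighbor_inj z) sxy => //; rewrite hamming_dist_sym.
Qed.

(* The triangle [sigma x, sigma y, sigma z] lifts to a path [x, y, z', x'],
   which cannot close up: otherwise [z'] would be [z], not adjacent to [y]. *)
Lemma covering_fiber_dist_eq3 x y z :
    hamming_dist x y = 1 -> hamming_dist x z = 1 -> hamming_dist y z != 1 ->
    word_dist (sigma y) (sigma z) = 1 ->
  exists x', [/\ sigma x' = sigma x, x != x' & hamming_dist x x' = 3].
Proof.
move=> xy xz yz /covering_neighbor_lift[z' z'z yz'].
have [|x' x'x z'x'] := @covering_neighbor_lift z' (sigma x).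
  by rewrite z'z word_dist_sym covering_neighbor.
have neq_xx' : x != x'.
  apply: contraNneq yz => xx'; rewrite -yz' -xx' in z'x' *.
  by rewrite (@covering_neighbor_inj x z z') // hamming_dist_sym z'x'.
exists x'; split=> //; apply/eqP.
rewrite eqn_leq covering_fiber_dist_ge3 // andbT.
apply: leq_trans (hamming_dist_triangle y _ _) _; rewrite xy ltnS.
by apply: leq_trans (hamming_dist_triangle z' _ _) _; rewrite yz' z'x'.
Qed.

Section PreimageCode.

Variable D : {set {ffun J -> W}}.

Local Notation C := (sigma @^-1: D).

Lemma dist_to_preim_le x s :
  s \in D -> dist_to_code x C <= word_dist (sigma x) s.
Proof.
move=> sD; have [c cs <-] := covering_lift x s.
rewrite /dist_to_code -minEnat -leEnat; apply: bigmin_le_cond.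
by rewrite inE cs.
Qed.

Lemma dist_to_preim_attained x : D != set0 ->
  exists2 s, s \in D & dist_to_code x C = word_dist (sigma x) s.
Proof.
case/set0Pn => s0 s0D; have [c0 c0s0] := covering_surj s0.
have c0C : c0 \in C by rewrite inE c0s0.
have [|c cC xc] := @eq_bigmin _ _ _ n c0 [in C] (hamming_dist x) c0C.
  by move=> c _; apply: leq_trans (max_card _) _; rewrite card_ord.
have sD : sigma c \in D by rewrite inE in cC.
exists (sigma c) => //; apply/eqP; rewrite eqn_leq dist_to_preim_le //.
by rewrite {1}/dist_to_code -minEnat xc covering_dist_le.
Qed.

Lemma sum_walk_count_preim k x :
  \sum_(c in C) walk_count n #|F| k (hamming_dist x c) =
  \sum_(s in D) walk_count #|J| #|W| k (word_dist (sigma x) s).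
Proof.
elim: k x => [|k IHk] x.
  rewrite /walk_count /=; under eq_bigr do rewrite hamming_dist_eq0.
  under [RHS]eq_bigr do rewrite word_dist_eq0.
  by rewrite !sum_eq_mem inE.
rewrite /walk_count !iterS -!/(walk_count _ _ k).
under eq_bigr do rewrite -sum_neighbors_hamming_dist.
under [RHS]eq_bigr do rewrite -sum_neighbors_word_dist.
rewrite exchange_big [RHS]exchange_big /=.
by under eq_bigr do rewrite IHk; rewrite -sum_neighbors_covering.
Qed.

Lemma codewords_at_span (R : numFieldType) k (phi : nat -> R) :
    (forall r, k <= r -> phi r = 0%R) ->
  exists alpha : nat -> R, forall x,
    (\sum_(i < k) alpha i * (codewords_at C i x)%:R =
     \sum_(s in D) phi (word_dist (sigma x) s))%R.
Proof.
elim: k phi => [|k IHk] phi phi_supp.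
  exists (fun=> 0%R) => x; rewrite big_ord0 big1 // => s _.
  by rewrite phi_supp.
pose coef : R := (phi k / k`!%:R)%R.
have [r kr|alpha alphaE] :=
  IHk (fun r => phi r - coef * (walk_count #|J| #|W| k r)%:R)%R.
  move: kr; rewrite leq_eqVlt => /predU1P[<-|kr].
    by rewrite walk_count_diag divfK ?subrr // pnatr_eq0 -lt0n fact_gt0.
  by rewrite walk_count_eq0 // phi_supp // mulr0 subr0.
exists (fun i => (if (i < k)%N then alpha i else 0)
                 + coef * (walk_count n #|F| k i)%:R)%R => x.
under eq_bigr do rewrite mulrDl -mulrA -natrM.
rewrite big_split -mulr_sumr -natr_sum /=.
have walkC r : k.+1 <= r -> walk_count n #|F| k r = 0 by exact: walk_count_eq0.
rewrite -(sum_codewords_at C x walkC) sum_walk_count_preim natr_sum mulr_sumr.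
rewrite big_ord_recr /= ltnn mul0r addr0.
under eq_bigr do rewrite ltn_ord.
by rewrite alphaE -big_split; apply: eq_bigr => s _ /=; rewrite subrK.
Qed.

End PreimageCode.

Section ConstantWordsPreimage.

Local Notation C := (sigma @^-1: constant_words J W).

Hypothesis J_gt0 : 0 < #|J|.

Lemma constant_words_neq0 : constant_words J W != set0.
Proof.
have /card_gt0P[j _] := J_gt0; apply/set0Pn; exists [ffun=> sigma 0%R j].
exact: imset_f.
Qed.

Lemma dist_to_constant_preim x :
  dist_to_code x C = #|J| - max_multiplicity (sigma x).
Proof.
apply/eqP; rewrite eqn_leq; apply/andP; split.
  have [a <-] := max_multiplicity_attained (sigma x) J_gt0.
  by rewrite -word_dist_const dist_to_preim_le ?imset_f.
have [_ /imsetP[a _ ->] ->] := dist_to_preim_attained x constant_words_neq0.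
by rewrite word_dist_const leq_sub2l ?multiplicity_le_max.
Qed.

Lemma covering_radius_constant_preim : #|J| <= #|W| ->
  covering_radius C = #|J|.-1.
Proof.
move=> leJW; apply/eqP; rewrite eqn_leq; apply/andP; split.
  apply/bigmax_leqP => x _; rewrite dist_to_constant_preim -subn1 leq_sub2l //.
  exact: max_multiplicity_gt0.
have [s s_inj] : exists s : {ffun J -> W}, injective s.
  exists [ffun j => enum_val (widen_ord leJW (enum_rank j))] => i j.
  by rewrite !ffunE => /enum_val_inj[] /val_inj/enum_rank_inj.
have [x xs] := covering_surj s; apply: leq_trans (leq_bigmax x).
rewrite dist_to_constant_preim xs -subn1 leq_sub2l //.
exact/injective_max_multiplicity_le1.
Qed.

Lemma uniformly_packed_constant_preim : #|J| <= #|W| ->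
  uniformly_packed_wide C.
Proof.
move=> leJW; pose phi r : rat := ((#|J| - r)%:R / #|J|%:R)%R.
have [r|alpha alphaE] :=
  codewords_at_span (constant_words J W) (k := #|J|) (phi := phi).
  by rewrite /phi -subn_eq0 => /eqP ->; rewrite mul0r.
exists (fun k => alpha k) => x.
rewrite -(big_mkord xpredT (fun k => alpha k * (codewords_at C k x)%:R))%R.
rewrite covering_radius_constant_preim // prednK // big_mkord alphaE.
rewrite big_imset /=; last by move=> a b _ _ /(const_word_inj J_gt0).
under eq_bigr do rewrite /phi word_dist_const subKn ?multiplicity_le_card //.
by rewrite -mulr_suml -natr_sum sum_multiplicity divff // pnatr_eq0 -lt0n.
Qed.

Lemma constant_preim_dist_ge3 x y : 3 <= #|J| ->
  x \in C -> y \in C -> x != y -> 3 <= hamming_dist x y.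
Proof.
rewrite !inE => J3 /imsetP[a _ xa] /imsetP[b _ yb] xy.
have [eq_ab|neq_ab] := eqVneq a b.
  by apply: covering_fiber_dist_ge3 xy; rewrite xa yb eq_ab.
apply: leq_trans J3 (leq_trans _ (covering_dist_le x y)).
by rewrite xa yb word_dist_const_const.
Qed.

Lemma neighbors_in_inner_shell_constant_preim x :
  neighbors_in (code_shell C ((dist_to_code x C)%:Z - 1)%R) x =
  dist_to_code x C * #|modes (sigma x)|.
Proof.
rewrite [in RHS]dist_to_constant_preim -card_neighbors_max_multiplicityS.
rewrite -sum1dep_card big_mkcondr /= -sum_neighbors_covering.
rewrite -big_mkcondr /= sum1dep_card; apply: eq_card => y; rewrite !inE.
rewrite andbC !dist_to_constant_preim; congr (_ && _).
have := max_multiplicity_le_card (sigma x).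
have := max_multiplicity_le_card (sigma y).
by lia.
Qed.

Lemma not_completely_regular_constant_preim s t :
    max_multiplicity s < #|J| -> max_multiplicity s = max_multiplicity t ->
    #|modes s| != #|modes t| ->
  ~ completely_regular C.
Proof.
move=> s_lt st modes_st regular.
have [x xs] := covering_surj s; have [y yt] := covering_surj t.
have dxy : dist_to_code y C = dist_to_code x C.
  by rewrite !dist_to_constant_preim xs yt st.
have [||+ _] := regular (dist_to_code x C) x y; rewrite ?inE ?dxy //.
rewrite neighbors_in_inner_shell_constant_preim -dxy.
rewrite neighbors_in_inner_shell_constant_preim dxy => /eqP.
rewrite eqn_pmul2l; first by rewrite xs yt (negPf modes_st).
by rewrite dist_to_constant_preim xs subn_gt0.
Qed.

End ConstantWordsPreimage.

End Coverings.

Local Open Scope ring_scope.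

Lemma dim_parity_check_code (F : finFieldType) r n (M : 'M[F]_(r, n)) :
  row_free M ->
  exists V : {vspace 'rV[F]_n}, parity_check_code M =i V /\ \dim V = (n - r)%N.
Proof.
move=> /row_freeP[B MB1].
pose f : 'Hom('rV[F]_n, 'rV[F]_r) := linfun (mulmxr M^T).
have f_surj : limg f = fullv.
  apply/vspaceP => z; rewrite memvf; apply/memv_imgP.
  exists (z *m B^T); rewrite ?memvf // lfunE /= -mulmxA -trmx_mul MB1.
  by rewrite trmx1 mulmx1.
exists (lker f); split=> [x|].
  rewrite memv_ker inE lfunE /= -[in RHS](trmxK x) -trmx_mul.
  by rewrite -(inj_eq trmx_inj) trmx0.
have := limg_ker_dim f fullv; rewrite capfv f_surj !dimvf !dim_matrix !mul1r.
by move=> dimE; rewrite -[LHS](addnK r) [X in (X - _)%N]dimE.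
Qed.

Section KroneckerProduct.

Lemma tensmx11 (R : pzRingType) m n : 1%:M *t 1%:M = 1%:M :> 'M[R]_(m * n).
Proof.
apply/matrixP => k l; case: (mxtens_indexP k) => i j.
case: (mxtens_indexP l) => i' j'; rewrite tensmxE !mxE -natrM mulnb.
by rewrite (can_eq (@mxtens_indexK _ _)).
Qed.

Lemma row_free_tensmx (F : fieldType) m n p q (A : 'M[F]_(m, n))
    (B : 'M[F]_(p, q)) : row_free A -> row_free B -> row_free (A *t B).
Proof.
move=> /row_freeP[A' AA'] /row_freeP[B' BB']; apply/row_freeP.
by exists (A' *t B'); rewrite tensmx_mul AA' BB' tensmx11.
Qed.

Lemma sum_mxtens (V : nmodType) m n (f : 'I_(m * n) -> V) :
  \sum_k f k = \sum_j \sum_i f (mxtens_index (i, j)).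
Proof.
rewrite exchange_big pair_big (reindex (@mxtens_index m n)) /=.
  by apply: eq_bigr => -[].
by exists (@mxtens_unindex m n) => ? _; rewrite ?mxtens_indexK ?mxtens_unindexK.
Qed.

Definition unfold_row (T : Type) m n (x : 'rV[T]_(m * n)) : 'M[T]_(m, n) :=
  \matrix_(i, j) x ord0 (mxtens_index (i, j)).

Lemma unfold_row_add_delta (R : pzRingType) m n (x : 'rV[R]_(m * n)) a i j :
  unfold_row (x + a *: delta_mx 0 (mxtens_index (i, j))) =
  unfold_row x + a *: delta_mx i j.
Proof.
apply/matrixP => k l; rewrite !mxE eqxx /= (can_eq (@mxtens_indexK _ _)).
by rewrite xpair_eqE.
Qed.

Lemma tensmx_mul_row (R : comPzRingType) m n p q (A : 'M[R]_(m, n))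
    (B : 'M[R]_(p, q)) (x : 'rV[R]_(n * q)) k l :
  (A *t B *m x^T) (mxtens_index (k, l)) 0 = (A *m unfold_row x *m B^T) k l.
Proof.
rewrite !mxE sum_mxtens; apply: eq_bigr => j _.
rewrite !mxE mulr_suml; apply: eq_bigr => i _.
by rewrite tensmxE !mxE mulrAC.
Qed.

Lemma parity_check_code_tensE (F : finFieldType) m n p q (A : 'M[F]_(m, n))
    (B : 'M[F]_(p, q)) x :
  (x \in parity_check_code (A *t B)) = (A *m unfold_row x *m B^T == 0).
Proof.
rewrite inE; apply/eqP/eqP => /matrixP AB0; apply/matrixP => k l.
  by rewrite -tensmx_mul_row AB0 !mxE.
by case: (mxtens_indexP k) => i j; rewrite ord1 tensmx_mul_row AB0 !mxE.
Qed.

End KroneckerProduct.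

Section RepetitionParityCheck.

Lemma map_repetition_pcm (R S : pzRingType) (f : {rmorphism R -> S}) n :
  map_mx f (repetition_pcm R n) = repetition_pcm S n.
Proof.
apply/matrixP => i j; rewrite !mxE; case: ifP => _; first by rewrite rmorph_nat.
by rewrite rmorphN1.
Qed.

Lemma mul_repetition_pcm_tr (R : comPzRingType) m n (Y : 'M[R]_(m, n.+1)) i p :
  (Y *m (repetition_pcm R n.+1)^T) i p =
  Y i (widen_ord (leq_subr 1 n.+1) p) - Y i ord_max.
Proof.
have p_lt := ltn_ord p; set p' := widen_ord _ p.
have p_neq : p' != ord_max by rewrite -val_eqE /=; lia.
rewrite mxE (bigD1 p') // (bigD1 ord_max) 1?eq_sym //= big1 ?addr0 => [|j].
  by rewrite !mxE /= p_lt eqxx mulr1 ifN ?mulrN1 //; lia.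
case/andP=> jp jm; rewrite !mxE ifT; last first.
  by have := ltn_ord j; rewrite -val_eqE /= in jm; lia.
by move: jp; rewrite -val_eqE /= eq_sym => /negPf ->; rewrite mulr0.
Qed.

Lemma mul_repetition_pcm_tr_eq0 (R : comPzRingType) m n (Y : 'M[R]_(m, n.+1)) :
  Y *m (repetition_pcm R n.+1)^T = 0 <-> forall j, col j Y = col ord_max Y.
Proof.
split=> [/matrixP YR0 j|Y_const]; last first.
  apply/matrixP => i p; rewrite mul_repetition_pcm_tr.
  have /colP/(_ i) := Y_const (widen_ord (leq_subr 1 n.+1) p).
  by rewrite !mxE => ->; rewrite subrr.
have [->//|j_neq] := eqVneq j ord_max.
have j_lt : (j < n.+1 - 1)%N.
  by have := ltn_ord j; rewrite -val_eqE /= in j_neq; lia.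
apply/colP => i; rewrite !mxE; apply/eqP; rewrite -subr_eq0.
have := YR0 i (Ordinal j_lt); rewrite mul_repetition_pcm_tr mxE => <-.
by apply/eqP; congr (Y i _ - _); exact: val_inj.
Qed.

Lemma row_free_repetition_pcm (F : fieldType) n :
  row_free (repetition_pcm F n.+1).
Proof.
apply/row_freeP; exists (\matrix_(j, p) (j == p :> nat)%:R).
apply: trmx_inj; rewrite trmx_mul trmx1; apply/matrixP => p p'.
rewrite mul_repetition_pcm_tr !mxE /= -(val_eqE p) eq_sym.
by rewrite (_ : (n == p) = false) ?subr0 //; have := ltn_ord p; lia.
Qed.

End RepetitionParityCheck.

Section SyndromeCovering.

Variables (F : finFieldType) (m na nb : nat) (H : 'M[F]_(m, na)).
Hypothesis H_hamming : hamming_columns H.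
Hypothesis na_card : (na * #|F|.-1 = (#|F| ^ m).-1)%N.
Implicit Types (x y : 'rV[F]_(na * nb)) (i : 'I_na) (j : 'I_nb) (a b : F).

Lemma scaled_column_inj i i' a b : a != 0 ->
  a *: col i H = b *: col i' H -> i = i' /\ a = b.
Proof.
case: H_hamming => col_neq0 cols_free a0 ab.
have [eq_ii'|/cols_free] := eqVneq i i'.
  split=> //; apply/eqP; move/eqP: ab; rewrite eq_ii' -subr_eq0 -scalerBl.
  by rewrite scaler_eq0 (negPf (col_neq0 i')) orbF subr_eq0.
rewrite free_cons span_seq1 => /andP[/vlineP[]]; exists (a^-1 * b).
by rewrite -scalerA -ab scalerA mulVf // scale1r.
Qed.

Lemma scaled_column_neq0 i a : a != 0 -> a *: col i H != 0.
Proof. by move=> a0; rewrite scaler_eq0 negb_or a0 (proj1 H_hamming). Qed.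

Lemma scaled_column_surj (w : 'cV[F]_m) : w != 0 ->
  exists i a, a != 0 /\ w = a *: col i H.
Proof.
pose D := setX [set: 'I_na] [set~ (0 : F)].
pose scaled (ia : 'I_na * F) := ia.2 *: col ia.1 H.
have scaled_inj : {in D &, injective scaled}.
  move=> [i a] [i' b]; rewrite !inE /= => a0 _ /(scaled_column_inj a0).
  by case=> /= -> ->.
have scaled_img : scaled @: D = [set~ 0].
  apply/eqP; rewrite eqEcard card_in_imset // cardsX cardsT card_ord !cardsC1.
  rewrite na_card card_mx muln1 leqnn andbT.
  apply/subsetP => _ /imsetP[[i a] + ->].
  by rewrite !inE /=; exact: scaled_column_neq0.
rewrite -in_setC1 -scaled_img => /imsetP[[i a]]; rewrite !inE /= => a0 ->.
by exists i, a.
Qed.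

Lemma row_free_hamming_columns : row_free H.
Proof.
apply: inj_row_free => v vH; apply/trmx_inj/colP => k; rewrite trmx0 [RHS]mxE.
have v_orthogonal w : v *m w = 0 :> 'M_1.
  have [->|/scaled_column_surj[i [a [_ ->]]]] := eqVneq w 0.
    exact: mulmx0.
  by rewrite -scalemxAr colE mulmxA vH mul0mx scaler0.
have := v_orthogonal (delta_mx k 0).
by rewrite -colE => /colP/(_ 0); rewrite !mxE.
Qed.

Definition syndrome x : {ffun 'I_nb -> 'cV[F]_m} :=
  [ffun j => col j (H *m unfold_row x)].

Lemma syndrome_add_delta x i j a :
  syndrome (x + a *: delta_mx 0 (mxtens_index (i, j))) =
  update (syndrome x) j (syndrome x j + a *: col i H).
Proof.
apply/ffunP => k; rewrite !ffunE unfold_row_add_delta mulmxDr !colE mulmxDl.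
rewrite -scalemxAr -scalemxAl -(mulmxA H (delta_mx i j)) mul_delta_mx_cond.
by rewrite eq_sym; case: eqP => [->|_]; rewrite ?mulmx0 ?scaler0 ?addr0.
Qed.

Lemma syndrome_covering : hamming_covering syndrome.
Proof.
move=> x; split.
  move=> y y'; rewrite !inE => /hamming_dist1P[p [a [a0 ->]]].
  case/hamming_dist1P=> p' [b [b0 ->]].
  case: (mxtens_indexP p) => i j; case: (mxtens_indexP p') => i' j'.
  rewrite !syndrome_add_delta => /ffunP/(_ j); rewrite !ffunE eqxx.
  have [->|_] := eqVneq j j'.
    by move/addrI/(scaled_column_inj a0) => [-> ->].
  by move/eqP; rewrite addr_eq_id (negPf (scaled_column_neq0 i a0)).
apply/setP => s; rewrite inE; apply/imsetP/eqP => [[y]|].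
  rewrite inE => /hamming_dist1P[p [a [a0 ->]]] ->.
  case: (mxtens_indexP p) => i j.
  rewrite syndrome_add_delta word_dist_update_self.
  by rewrite addr_eq_id scaled_column_neq0.
move/eqP/word_dist1P => [j [w [w_neq ->]]]; rewrite -subr_eq0 in w_neq.
have [i [a [a0 wE]]] := scaled_column_surj w_neq.
exists (x + a *: delta_mx 0 (mxtens_index (i, j))).
  by rewrite inE; apply/hamming_dist1P; exists (mxtens_index (i, j)), a.
by rewrite syndrome_add_delta -wE addrC subrK.
Qed.

Lemma syndrome_fiber_dist_eq3 x : (1 < na)%N -> (0 < nb)%N ->
  exists x', [/\ syndrome x' = syndrome x, x != x' & hamming_dist x x' = 3%N].
Proof.
move=> na_gt1 nb_gt0; pose j := Ordinal nb_gt0.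
pose i1 := Ordinal (ltnW na_gt1); pose i2 := Ordinal na_gt1.
pose y i := x + 1 *: delta_mx 0 (mxtens_index (i, j)).
have xy i : hamming_dist x (y i) = 1%N.
  apply/eqP/hamming_dist1P; exists (mxtens_index (i, j)), 1.
  by rewrite oner_neq0.
apply: (covering_fiber_dist_eq3 syndrome_covering (xy i1) (xy i2)).
  rewrite hamming_distE !word_of_row_add_delta word_dist_update_neq.
    by rewrite !ffunE !addr_eq_id oner_neq0.
  by rewrite (can_eq (@mxtens_indexK _ _)) xpair_eqE.
rewrite !syndrome_add_delta word_dist_update_same (inj_eq (addrI _)).
have [/(scaled_column_inj (oner_neq0 F))[]|//] :=
  eqVneq (1 *: col i1 H) (1 *: col i2 H).
by move/(congr1 val).
Qed.

End SyndromeCovering.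

Section HammingByRepetition.

Variables (F : finFieldType) (m na b : nat) (H : 'M[F]_(m, na)).
Hypothesis H_hamming : hamming_columns H.
Hypothesis na_card : (na * #|F|.-1 = (#|F| ^ m).-1)%N.

Local Notation C := (parity_check_code (H *t repetition_pcm F b.+1)).

Let sigma_cover := syndrome_covering (nb := b.+1) H_hamming na_card.

Lemma parity_check_code_syndromeE :
  C = @syndrome F m na b.+1 H @^-1: constant_words 'I_b.+1 'cV[F]_m.
Proof.
apply/setP => x; rewrite parity_check_code_tensE [RHS]inE.
apply/eqP/imsetP => [/mul_repetition_pcm_tr_eq0 HX_const|[w _ xw]].
  exists (col ord_max (H *m unfold_row x)) => //.
  by apply/ffunP => j; rewrite !ffunE HX_const.
apply/mul_repetition_pcm_tr_eq0 => j; move/ffunP: xw => xw.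
by have := xw j; have := xw ord_max; rewrite !ffunE => -> ->.
Qed.

Lemma min_distance_hamming_repetition : (1 < na)%N -> (1 < b)%N ->
  min_distance_is C 3.
Proof.
move=> na_gt1 b_gt1; rewrite parity_check_code_syndromeE; split; last first.
  by move=> x y; apply: constant_preim_dist_ge3; rewrite ?card_ord.
have [x xs] := covering_surj sigma_cover [ffun=> 0].
have [//|//|y [ys xy dxy]] :=
  syndrome_fiber_dist_eq3 (nb := b.+1) H_hamming na_card x.
by exists x, y; rewrite !inE ys xs imset_f.
Qed.

Lemma linear_code_params_hamming_repetition : (1 < na)%N -> (1 < b)%N ->
  linear_code_params C (na * b.+1 - m * (b.+1 - 1)) 3.
Proof.
split; last exact: min_distance_hamming_repetition.
apply/dim_parity_check_code/row_free_tensmx/row_free_repetition_pcm.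
exact: row_free_hamming_columns.
Qed.

Lemma covering_radius_hamming_repetition : (b < #|F| ^ m)%N ->
  covering_radius C = b.
Proof.
move=> b_lt; rewrite parity_check_code_syndromeE.
by rewrite covering_radius_constant_preim ?card_mx ?card_ord ?muln1.
Qed.

Lemma uniformly_packed_hamming_repetition : (b < #|F| ^ m)%N ->
  uniformly_packed_wide C.
Proof.
move=> b_lt; rewrite parity_check_code_syndromeE.
by apply: uniformly_packed_constant_preim; rewrite ?card_mx ?card_ord ?muln1.
Qed.

Lemma not_completely_regular_hamming_repetition : (2 < b)%N ->
  (b <= #|F| ^ m)%N -> ~ completely_regular C.
Proof.
rewrite parity_check_code_syndromeE; move: b sigma_cover => [|[|[|n]]] // cover.
move=> _ n_le; have W_ge : (n.+3 <= #|{: 'cV[F]_m}|)%N by rewrite card_mx muln1.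
have [s [t [s2 t2 modes_st]]] := exists_unequal_modes W_ge.
by apply: (not_completely_regular_constant_preim cover _ _ _ modes_st);
  rewrite ?card_ord ?s2 ?t2.
Qed.

End HammingByRepetition.

Lemma hamming_length_mul (Q m : nat) : (1 < Q)%N ->
  ((Q ^ m - 1) %/ (Q - 1) * Q.-1 = (Q ^ m).-1)%N.
Proof. by move=> Q_gt1; rewrite !subn1 predn_exp mulKn 1?mulnC; lia. Qed.

Lemma hamming_length_gt1 (Q m : nat) : (1 < Q)%N -> (1 < m)%N ->
  (1 < (Q ^ m - 1) %/ (Q - 1))%N.
Proof.
move=> Q_gt1 m_gt1; rewrite -(@ltn_pmul2r Q.-1); last by lia.
rewrite hamming_length_mul // mul1n.
by have := ltn_exp2l 1 m Q_gt1; rewrite expn1 m_gt1; lia.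
Qed.

Theorem theorem5p1 (q u m na nb : nat) (Fq FQ : finFieldType)
    (iota : {rmorphism Fq -> FQ}) (H : 'M[FQ]_(m, na))
    (hq : #|Fq| = q) (hQ : #|FQ| = (q ^ u)%N)
    (hu : (1 <= u)%N) (hm : (2 <= m)%N)
    (hna : na = ((q ^ (u * m) - 1) %/ (q ^ u - 1))%N)
    (hH : hamming_columns H)
    (hnb4 : (4 <= nb)%N) (hnb : (nb <= (q ^ u - 1) * na + 1)%N) :
  let C : {set 'rV[FQ]_(na * nb)} :=
    parity_check_code (H *t map_mx iota (repetition_pcm Fq nb)) in
  [/\ uniformly_packed_wide C,
      linear_code_params C (na * nb - m * (nb - 1)) 3
    & covering_radius C = (nb - 1)%N]
  /\ ~ completely_regular C.
Proof.
move=> C; rewrite {}/C map_repetition_pcm.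
have Q_gt1 : (1 < #|FQ|)%N := finNzRing_gt1 FQ.
have na_eq : na = ((#|FQ| ^ m - 1) %/ (#|FQ| - 1))%N by rewrite hQ -expnM.
have na_gt1 : (1 < na)%N by rewrite na_eq hamming_length_gt1.
have na_card : (na * #|FQ|.-1 = (#|FQ| ^ m).-1)%N.
  by rewrite na_eq hamming_length_mul.
have nb_le : (nb <= #|FQ| ^ m)%N.
  apply: leq_trans hnb _; rewrite -hQ subn1 mulnC na_card addn1 prednK //.
  by rewrite expn_gt0 ltnW.
case: nb hnb4 {hnb} nb_le => [//|b] b_ge3 b_lt; split.
  split; first exact: uniformly_packed_hamming_repetition.
    exact: linear_code_params_hamming_repetition (ltnW b_ge3).
  by rewrite covering_radius_hamming_repetition // subn1.
exact: not_completely_regular_hamming_repetition (ltnW b_lt).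
Qed.
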